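(* Let $n\geq 7$ be an integer and let $\lambda$ be an integer with $n-1\leq\lambda\leq n$. There exists an indecomposable $1$-factorization of $\lambda K_{2n}$ which is not simple.
   Context: The complete multigraph $\lambda K_{2n}$ has $2n$ vertices, and each pair of distinct vertices is joined by exactly $\lambda$ edges. A $1$-factor of $\lambda K_{2n}$ is a spanning subgraph consisting of $n$ pairwise independent edges (a perfect matching); two $1$-factors are regarded as equal if they consist of the same unordered pairs of vertices. A $1$-factorization of $\lambda K_{2n}$ is a partition of the edge-(multi)set of $\lambda K_{2n}$ into $1$-factors, i.e. a multiset of $1$-factors such that every pair of distinct vertices is covered exactly $\lambda$ times, counting multiplicities. A $1$-factorization is simple if no $1$-factor is repeated in it. It is decomposable if it is the (multiset) union of a $1$-factorization of $\lambda_0K_{2n}$ and a $1$-factorization of $(\lambda-\lambda_0)K_{2n}$ for some integer $\lambda_0$ with $1\le\lambda_0<\lambda$; otherwise it is indecomposable. *)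

(* Defs.v *)
From mathcomp Require Import all_boot.
From mathcomp Require Import finmap multiset.

Set Implicit Arguments.
Unset Strict Implicit.
Unset Printing Implicit Defensive.

Local Open Scope mset_scope.
Local Open Scope nat_scope.

(* An edge is the unordered pair of its endpoints.  Parallel edges of the
   multigraph are not told apart: a 1-factor is determined by the pairs of
   vertices it joins, and edge multiplicity is the number of 1-factors, counted
   with multiplicity, that contain the pair. *)
Definition is_edge (n : nat) (e : {set 'I_(2 * n)}) : bool := #|e| == 2.

(* [trivIset F] says that the edges of F are pairwise disjoint; being n in
   number, they cover all 2n vertices. *)
Definition one_factor (n : nat) (F : {set {set 'I_(2 * n)}}) : bool :=
  [&& [forall e in F, is_edge e], trivIset F & #|F| == n].

(* [enum_mset M] lists the members of the multiset M with repetitions. *)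
Definition one_factorization (n lam : nat)
    (M : {mset {set {set 'I_(2 * n)}}}) : Prop :=
  (forall F, F \in M -> one_factor F) /\
  (forall e : {set 'I_(2 * n)}, is_edge e ->
     count (fun F : {set {set 'I_(2 * n)}} => e \in F) (enum_mset M) = lam).

Definition simple (n : nat) (M : {mset {set {set 'I_(2 * n)}}}) : Prop :=
  forall F, M F <= 1.

Definition decomposable (n lam : nat)
    (M : {mset {set {set 'I_(2 * n)}}}) : Prop :=
  exists (lam0 : nat) (M0 M1 : {mset {set {set 'I_(2 * n)}}}),
    [/\ 1 <= lam0 < lam,
        one_factorization lam0 M0,
        one_factorization (lam - lam0) M1
      & M = M0 `+` M1].

Definition indecomposable (n lam : nat)
    (M : {mset {set {set 'I_(2 * n)}}}) : Prop :=
  ~ decomposable lam M.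

(* Main.v *)
Require Import Defs.
From mathcomp Require Import all_boot.
From mathcomp Require Import finmap multiset.
From mathcomp Require Import zify.

(** Put n = h + 1. Split the vertices into the 2h + 1 points of a complete
    graph and one further point, the apex. The classical zigzag construction
    of Walecki decomposes that complete graph into h Hamilton cycles of odd
    length 2h + 1. For a cycle and one of its points k there is exactly one
    perfect matching of all the vertices that joins k to the apex and
    otherwise uses edges of the cycle. These (2h + 1)h matchings, the cycle
    factors, form a 1-factorization of h K_2n ([count_all_indices]).

    They force indecomposability. Let M0 be a 1-factorization of lam0 K_2n
    whose 1-factors meet the edges of a given cycle only as cycle factors do.
    At a point of the cycle, every cycle factor in M0 uses exactly one of the
    two cycle edges there, except the one that sends this point to the apex.
    As the two edges are covered 2 lam0 times, the multiplicity in M0 of the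
    cycle factor of k is the same for all k ([global_balance]). A cycle
    factor that occurs only once in the whole 1-factorization is missing from
    one of the two parts of a decomposition; then that part contains no cycle
    factor, so it covers no edge of the cycle, and its index is 0. This only
    looks at one cycle, so the 1-factors of the other cycles can be changed
    freely by trades: if a vertex set S is closed under two perfect
    matchings, exchanging them on S gives two perfect matchings that cover
    the same edges ([count_trade]).

    For lam = n - 1 = h, two trades between cycle factors of cycle 0 and one
    of another cycle j turn the cycle factor of a point b of cycle 0 into
    that of the point v at distance 2 from b ([twice_kb]). The latter is then
    repeated, and cycle 1 is intact.

    For lam = n, add a 1-factorization of K_2n to the cycle factors. It
    consists of the cycle factors of the two points in the middle of each
    cycle, and of the pairing of antipodes ([count_halves]): the edge between
    the two middle points is the one cycle edge that the two factors omit,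
    and these omitted edges together form the pairing of antipodes. Middle
    cycle factors now occur twice. The result is decomposable, but one trade
    between the pairing and a cycle factor of cycle 0 destroys the
    decomposition. The balance at a cycle other than 0 still holds, with a
    correction at the two middle points for the 1-factors that are not cycle
    factors and contain the middle edge. If the part M0 lacks a cycle factor
    of cycle 1 that is not a middle one, then lam0 is the number of these
    exceptional 1-factors ([sub_index_of_missing]). After the trade they all
    contain the edge e from the apex to vertex 1, so they exhaust the lam0
    occurrences of e in M0. But e also lies in a middle cycle factor of
    another cycle, which is thus missing from M0, and the balance at that
    cycle gives lam0 = 0 ([sub_index0_of_missing_middle]). *)

Set Implicit Arguments.
Unset Strict Implicit.
Unset Printing Implicit Defensive.

Local Open Scope mset_scope.
Local Open Scope nat_scope.

(** * One-factors as involutions *)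

(** Perfect matchings are handled as functions on natural numbers, whose
    values matter below [2 * n] only: vertices can then be computed with by
    linear arithmetic. *)
Definition is_matching (n : nat) (g : nat -> nat) : Prop :=
  forall x, x < 2 * n -> [/\ g x < 2 * n, g (g x) = x & g x != x].

Definition factor_of (n : nat) (g : nat -> nat) : {set {set 'I_(2 * n)}} :=
  [set [set x; insubd x (g x)] | x : 'I_(2 * n)].

Lemma mem_factor_of n g (x y : 'I_(2 * n)) : is_matching n g -> x != y ->
  ([set x; y] \in factor_of n g) = (g x == y).
Proof.
move=> gM neq_xy; have val_ins (z : 'I_(2 * n)) : val (insubd z (g z)) = g z.
  by rewrite val_insubd; have [-> _ _] := gM z (ltn_ord z).
apply/imsetP/eqP => [[z _ exy]|gxy].
  have [zx zy] : z \in [set x; y] /\ insubd z (g z) \in [set x; y].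
    by rewrite exy !inE !eqxx orbT.
  have [_ ggz gz] := gM z (ltn_ord z).
  move: zx zy; rewrite !inE => /orP[]/eqP ? /orP[]/eqP e; subst z.
  - by move: gz; rewrite -(val_ins x) e eqxx.
  - by rewrite -val_ins e.
  - by rewrite -ggz -(val_ins y) e.
  - by move: gz; rewrite -(val_ins y) e eqxx.
exists x => //; congr [set _; _].
by apply: val_inj; rewrite val_ins gxy.
Qed.

Lemma factor_of_one_factor n g : is_matching n g -> one_factor (factor_of n g).
Proof.
move=> gM; have val_ins (z : 'I_(2 * n)) : val (insubd z (g z)) = g z.
  by rewrite val_insubd; have [-> _ _] := gM z (ltn_ord z).
have edge e : e \in factor_of n g -> #|e| = 2.
  case/imsetP => x _ ->; rewrite cards2; have [_ _ gx] := gM x (ltn_ord x).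
  by rewrite -(inj_eq val_inj) val_ins eq_sym gx.
have block (x : 'I_(2 * n)) e : e \in factor_of n g -> x \in e ->
    e = [set x; insubd x (g x)].
  case/imsetP => z _ ->; rewrite !inE => /orP[]/eqP-> //.
  rewrite setUC; congr [set _; _]; apply: val_inj.
  by rewrite !val_ins; have [_ -> _] := gM z (ltn_ord z).
have triv : trivIset (factor_of n g).
  apply/trivIsetP => A B FA FB; apply: contraR => /pred0Pn[x /andP[xA xB]].
  by apply/eqP; rewrite (block x A) // (block x B).
apply/and3P; split=> //; first by apply/forall_inP => e /edge/eqP.
have part : partition (factor_of n g) [set: 'I_(2 * n)].
  apply/and3P; split=> //.
    apply/eqP/setP => x; rewrite inE; apply/bigcupP.
    exists [set x; insubd x (g x)]; last by rewrite !inE eqxx.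
    by apply/imsetP; exists x.
  by apply/negP => /edge; rewrite cards0.
have := card_uniform_partition edge part; rewrite cardsT card_ord => card_n.
by rewrite -(eqn_pmul2r (isT : 0 < 2)) -card_n mulnC.
Qed.

Definition edge (n x y : nat) : {set 'I_(2 * n)} :=
  [set v : 'I_(2 * n) | (val v == x) || (val v == y)].

Lemma edgeE n (x y : 'I_(2 * n)) : edge n x y = [set x; y].
Proof. by apply/setP => v; rewrite !inE. Qed.

Lemma mem_factor n g x y : is_matching n g -> x < 2 * n -> y < 2 * n ->
  x != y -> (edge n x y \in factor_of n g) = (g x == y).
Proof.
move=> gM ltx lty neq_xy.
by rewrite -(mem_factor_of gM (x := Ordinal ltx) (y := Ordinal lty)) -?edgeE.
Qed.

Lemma edge_is_edge n x y : x < 2 * n -> y < 2 * n -> x != y ->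
  is_edge (edge n x y).
Proof.
move=> ltx lty neq_xy; rewrite /is_edge.
have -> : edge n x y = [set Ordinal ltx; Ordinal lty] by rewrite -edgeE.
by rewrite cards2 -(inj_eq val_inj) neq_xy.
Qed.

Lemma eq_factor_of n g g' :
  (forall x, x < 2 * n -> g x = g' x) -> factor_of n g = factor_of n g'.
Proof. by move=> gg'; apply: eq_imset => x; rewrite gg'. Qed.

Lemma factor_of_inj n g g' x : is_matching n g -> is_matching n g' ->
  factor_of n g = factor_of n g' -> x < 2 * n -> g x = g' x.
Proof.
move=> gM gM' eF ltx; have [ltg _ gx] := gM x ltx.
rewrite eq_sym in gx.
have := mem_factor gM ltx ltg gx; rewrite eF mem_factor // eqxx.
by move/eqP.
Qed.

Definition factors (n : nat) (T : Type) (Phi : T -> nat -> nat) (s : seq T) :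
    {mset {set {set 'I_(2 * n)}}} :=
  seq_mset [seq factor_of n (Phi t) | t <- s].

Lemma mem_factors n (T : eqType) (Phi : T -> nat -> nat) s F :
  F \in factors n Phi s -> exists2 t, t \in s & F = factor_of n (Phi t).
Proof.
rewrite -[F \in _]/(F \in enum_mset (factors n Phi s)).
by rewrite (perm_mem (perm_eq_seq_mset _)) => /mapP.
Qed.

Lemma one_factorization_factors n lam (T : eqType) (Phi : T -> nat -> nat) s :
  (forall t, t \in s -> is_matching n (Phi t)) ->
  (forall x y, x < 2 * n -> y < 2 * n -> x != y ->
     count (fun t => Phi t x == y) s = lam) ->
  one_factorization lam (factors n Phi s).
Proof.
move=> PhiM cov; split=> [F /mem_factors[t st ->]|e].
  exact/factor_of_one_factor/PhiM.
case/cards2P => x [y [neq_xy ->]].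
rewrite (permP (perm_eq_seq_mset _)) count_map -(cov x y) //.
apply: eq_in_count => t /PhiM tM /=.
by rewrite mem_factor_of.
Qed.

Lemma not_simple_of_count (n : nat) (T : eqType) (Phi : T -> nat -> nat) s t :
  1 < count_mem t s -> ~ simple (factors n Phi s).
Proof.
move=> ct /(_ (factor_of n (Phi t))); rewrite mset_seqE count_map.
apply/negP; rewrite -ltnNge; apply: leq_trans ct _.
by apply: sub_count => u /= /eqP->.
Qed.

Lemma not_simple_of_eq (n : nat) (T : eqType) (Phi : T -> nat -> nat) s t u :
  t \in s -> u \in s -> t != u ->
  factor_of n (Phi t) = factor_of n (Phi u) -> ~ simple (factors n Phi s).
Proof.
move=> ts us neq eq_tu /(_ (factor_of n (Phi t))); rewrite mset_seqE count_map.
apply/negP; rewrite -ltnNge.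
have us' : u \in rem t s.
  have := perm_mem (perm_to_rem ts) u.
  by rewrite us inE eq_sym (negPf neq) => /esym.
rewrite (permP (perm_to_rem ts)) /= eqxx.
by rewrite (permP (perm_to_rem us')) /= -eq_tu eqxx.
Qed.

(** A 1-factor that occurs once lies in only one of the two parts of a
    decomposition, so it is enough to show that a part without it is empty. *)
Lemma indecomposable_of_unique n lam (M : {mset {set {set 'I_(2 * n)}}}) F :
  M F <= 1 ->
  (forall lam0 (M0 : {mset {set {set 'I_(2 * n)}}}),
     one_factorization lam0 M0 -> (forall G, G \in M0 -> G \in M) ->
     M0 F = 0 -> lam0 = 0) ->
  indecomposable lam M.
Proof.
move=> MF1 no_part [lam0 [M0 [M1 [lam0P fact0 fact1 eM]]]].
move: MF1; rewrite eM msetE2 => MF1.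
have [M0F|] := eqVneq (M0 F) 0.
  suff : lam0 = 0 by lia.
  by apply: (no_part _ _ fact0) => // G GM0; rewrite eM in_msetD GM0.
move=> M0F; suff : lam - lam0 = 0 by lia.
apply: (no_part _ _ fact1); last by lia.
by move=> G GM1; rewrite eM in_msetD GM1 orbT.
Qed.

(** * Trades *)

Definition transpose (T : eqType) (a b t : T) : T :=
  if t == a then b else if t == b then a else t.

Lemma transposeK (T : eqType) (a b : T) : involutive (transpose a b).
Proof.
move=> t; rewrite /transpose.
have [->|neq_ta] := eqVneq t a; first by rewrite eqxx; case: eqP.
have [->|neq_tb] := eqVneq t b; first by rewrite eqxx.
by rewrite (negPf neq_ta) (negPf neq_tb).
Qed.

(** The matchings of index [a] and [b] exchange their values on [S].
    Exchanging indices instead of values makes the invariance of the edge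
    counts a statement about a permutation of the list of indices. *)
Definition trade (T : eqType) (S : seq nat) (a b : T) (Phi : T -> nat -> nat)
    (t : T) (x : nat) : nat :=
  Phi (if x \in S then transpose a b t else t) x.

(** At each vertex a trade either does nothing or renames the indices. *)
Lemma count_trade (T : eqType) S (a b : T) Phi s x y :
  count_mem a s = count_mem b s ->
  count (fun t => trade S a b Phi t x == y) s =
  count (fun t => Phi t x == y) s.
Proof.
move=> eq_ab; rewrite /trade; case: (x \in S) => //.
rewrite -(count_map (transpose a b) (fun t => Phi t x == y)).
apply/permP: (fun t => Phi t x == y); apply/allP => c _ /=.
rewrite count_map; apply/eqP.
have -> : count (preim (transpose a b) (pred1 c)) s =
          count_mem (transpose a b c) s.
  by apply: eq_count => t /=; rewrite -(can_eq (transposeK a b)) transposeK.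
rewrite /transpose; have [->|_] := eqVneq c a => //.
by have [->|_] := eqVneq c b.
Qed.

(** If [S] is closed under both matchings, so is its complement, and each of
    the traded matchings is on [S] and off [S] one of the two involutions. *)
Lemma trade_matching n (T : eqType) S (a b t : T) Phi :
  is_matching n (Phi a) -> is_matching n (Phi b) -> is_matching n (Phi t) ->
  {in S, forall x, x < 2 * n /\ (Phi a x \in S) && (Phi b x \in S)} ->
  is_matching n (trade S a b Phi t).
Proof.
move=> aM bM tM closed.
have [t_ab|] := boolP (t \in [:: a; b]); last first.
  rewrite !inE negb_or => /andP[ta tb] x ltx.
  by rewrite /trade /transpose (negPf ta) (negPf tb) !if_same; apply: tM.
pose sw := transpose a b t.
have sw_ab : sw \in [:: a; b].
  move: t_ab; rewrite /sw /transpose !inE => /orP[]/eqP->.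
    by rewrite eqxx eqxx orbT.
  by rewrite eqxx; case: (b =P a) => _; rewrite eqxx ?orbT.
have swM : is_matching n (Phi sw) by move: sw_ab; rewrite !inE => /orP[]/eqP->.
have inS u x : u \in [:: a; b] -> x < 2 * n -> (Phi u x \in S) = (x \in S).
  move=> u_ab ltx; have uM : is_matching n (Phi u).
    by move: u_ab; rewrite !inE => /orP[]/eqP->.
  have uS z : z \in S -> Phi u z \in S.
    by case/closed=> _ /andP[aS bS]; move: u_ab; rewrite !inE => /orP[]/eqP->.
  have [_ uu _] := uM x ltx; apply/idP/idP => [/uS|/uS //].
  by rewrite uu.
move=> x ltx; rewrite /trade -/sw.
by case: ifP => xS; rewrite inS // xS; [apply: swM|apply: tM].
Qed.

Lemma trade_out (T : eqType) S (a b : T) Phi t x :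
  x \notin S -> trade S a b Phi t x = Phi t x.
Proof. by rewrite /trade => /negPf->. Qed.

Lemma trade_other (T : eqType) S (a b : T) Phi t x :
  t != a -> t != b -> trade S a b Phi t x = Phi t x.
Proof. by rewrite /trade /transpose => /negPf-> /negPf->; rewrite if_same. Qed.

Lemma trade_in_l (T : eqType) S (a b : T) Phi x :
  x \in S -> trade S a b Phi a x = Phi b x.
Proof. by rewrite /trade /transpose eqxx => ->. Qed.

Lemma trade_in_r (T : eqType) S (a b : T) Phi x :
  x \in S -> trade S a b Phi b x = Phi a x.
Proof.
by rewrite /trade /transpose => ->; rewrite eqxx; case: (b =P a) => [->|].
Qed.

Lemma trade_ind (Q : nat -> Prop) (T : eqType) S (a b t : T) Phi x :
  Q (Phi a x) -> Q (Phi b x) -> Q (Phi t x) -> Q (trade S a b Phi t x).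
Proof. by rewrite /trade /transpose => Qa Qb Qt; do !case: ifP. Qed.

(** * Walecki's Hamilton cycles *)

Ltac find_if t k :=
  match t with
  | context [if ?b then _ else _] =>
     lazymatch b with
     | context [if _ then _ else _] => find_if b k
     | _ => k b
     end
  end.

(** Decides piecewise linear goals: every conditional is split and the
    inconsistent branches are pruned at once. *)
Ltac ifs :=
  simpl;
  repeat match goal with
  | |- ?G => find_if G ltac:(fun b =>
      let E := fresh "E" in case E: b; try (exfalso; lia))
  | H : ?G |- _ => find_if G ltac:(fun b =>
      let E := fresh "E" in revert H; case E: b => H; try (exfalso; lia))
  end; try lia.

Definition nextp h p := if p == 2 * h then 0 else p.+1.

Definition prevp h p := if p == 0 then 2 * h else p.-1.

Definition adj h p q := (q == nextp h p) || (p == nextp h q).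

(** Vertices below [2 * h] are the integers modulo [2 * h]; [2 * h] is the
    hub of the cycles and [(2 * h).+1] the apex. Cycle [i] visits the hub at
    place 0, and then i, i + 1, i - 1, i + 2, i - 2, and so on up to i + h.
    The apex has the extra place [(2 * h).+1], so that [walecki h i] permutes
    all vertices. *)
Definition walecki (h i p : nat) : nat :=
  if p == 0 then 2 * h
  else if p == (2 * h).+1 then (2 * h).+1
  else if odd p then (if p./2 <= i then i - p./2 else i + 2 * h - p./2)
  else if i + p./2 < 2 * h then i + p./2 else i + p./2 - 2 * h.

(** The place in cycle [i] of the vertex [i + d]. *)
Definition zig (h d : nat) : nat :=
  if d == 0 then 1 else if d <= h then d.*2 else (2 * h - d).*2.+1.

Definition place (h i x : nat) : nat :=
  if x == 2 * h then 0
  else if x == (2 * h).+1 then (2 * h).+1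
  else zig h (if i <= x then x - i else x + 2 * h - i).

Lemma placeK h i x : i < h -> x <= (2 * h).+1 ->
  walecki h i (place h i x) = x.
Proof. rewrite /walecki /place /zig => *; ifs. Qed.

Lemma waleckiK h i p : i < h -> p <= (2 * h).+1 ->
  place h i (walecki h i p) = p.
Proof. rewrite /walecki /place /zig => *; ifs. Qed.

Lemma walecki_le h i p : i < h -> p <= (2 * h).+1 ->
  walecki h i p <= (2 * h).+1.
Proof. rewrite /walecki => *; ifs. Qed.

Lemma place_le h i x : i < h -> x <= (2 * h).+1 ->
  place h i x <= (2 * h).+1.
Proof. rewrite /place /zig => *; ifs. Qed.

Lemma walecki_lt h l p : l < h -> p <= (2 * h).+1 ->
  walecki h l p < 2 * h.+1.
Proof. by move=> ltl lep; have := walecki_le ltl lep; lia. Qed.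

Lemma walecki_eq h i p q : i < h -> p <= (2 * h).+1 -> q <= (2 * h).+1 ->
  (walecki h i p == walecki h i q) = (p == q).
Proof.
move=> lti lep leq; apply/eqP/eqP => [/(congr1 (place h i))|-> //].
by rewrite !waleckiK.
Qed.

Lemma nextp_le h p : p <= 2 * h -> nextp h p <= 2 * h.
Proof. rewrite /nextp => *; ifs. Qed.

Lemma prevp_le h p : p <= 2 * h -> prevp h p <= 2 * h.
Proof. rewrite /prevp => *; ifs. Qed.

Lemma prevpK h p : p <= 2 * h -> nextp h (prevp h p) = p.
Proof. rewrite /prevp /nextp => *; ifs. Qed.

Lemma nextp_neq h p : 0 < h -> p != nextp h p.
Proof. rewrite /nextp => *; ifs. Qed.

Lemma cycle_edge_neq h l p : l < h -> p <= 2 * h ->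
  walecki h l p != walecki h l (nextp h p).
Proof.
move=> ltl lep; rewrite walecki_eq ?nextp_neq ?leqW ?nextp_le //.
exact: leq_ltn_trans ltl.
Qed.

(** The three sums are those congruent to 0 or 1 modulo [2 * h]; the sum 0
    itself would need [d = e]. *)
Lemma adj_zig h d e : d < 2 * h -> e < 2 * h -> d != e ->
  adj h (zig h d) (zig h e) = (d + e \in [:: 1; 2 * h; (2 * h).+1]).
Proof. rewrite /adj /zig /nextp !inE => *; ifs. Qed.

(** Consecutive residues of cycle [i] have sum [2 * i] or [(2 * i).+1] modulo
    [2 * h], and the neighbours of the hub are [i] and [i + h]. *)
Definition cycle_of h x y :=
  if x == 2 * h then (if y < h then y else y - h)
  else if y == 2 * h then (if x < h then x else x - h)
  else (if x + y < 2 * h then x + y else x + y - 2 * h)./2.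

Lemma cycle_of_lt h x y : 0 < h -> x <= 2 * h -> y <= 2 * h -> x != y ->
  cycle_of h x y < h.
Proof. rewrite /cycle_of => *; ifs. Qed.

(** The cycles partition the edges of the complete graph. *)
Lemma adj_cycle_of h i x y : i < h -> x <= 2 * h -> y <= 2 * h -> x != y ->
  adj h (place h i x) (place h i y) = (i == cycle_of h x y).
Proof.
rewrite /cycle_of => lti lex ley neq.
have [ex|?] := eqVneq x (2 * h); first
  by subst x; rewrite /adj /nextp /place /zig; ifs.
have [ey|?] := eqVneq y (2 * h); first
  by subst y; rewrite /adj /nextp /place /zig; ifs.
have [ltx lty] : x < 2 * h /\ y < 2 * h by lia.
have [nx ny] : (x == (2 * h).+1) = false /\ (y == (2 * h).+1) = false by lia.
rewrite /place !(ltn_eqF ltx) !(ltn_eqF lty) nx ny.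
rewrite adj_zig ?inE; ifs.
Qed.

(** * Near-perfect matchings of the cycles *)

(** On places, the matching with [k] joined to the apex. The places at odd
    distance after [k] are matched forwards, those at even distance
    backwards; the parity test accounts for the odd length of the cycle when
    [p] precedes [k]. *)
Definition cycle_match (h k p : nat) : nat :=
  if p == (2 * h).+1 then k
  else if p == k then (2 * h).+1
  else if odd (p + k) == (k < p) then (if p == 2 * h then 0 else p.+1)
  else (if p == 0 then 2 * h else p.-1).

Lemma cycle_matchK h k p : k <= 2 * h -> p <= (2 * h).+1 ->
  cycle_match h k (cycle_match h k p) = p.
Proof. rewrite /cycle_match => *; ifs. Qed.

Lemma cycle_match_le h k p : k <= 2 * h -> p <= (2 * h).+1 ->
  cycle_match h k p <= (2 * h).+1.
Proof. rewrite /cycle_match => *; ifs. Qed.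

Lemma cycle_match_neq h k p : k <= 2 * h -> p <= (2 * h).+1 ->
  cycle_match h k p != p.
Proof. rewrite /cycle_match => *; ifs. Qed.

Lemma cycle_match_vertex h k p : 0 < h -> k <= 2 * h -> p <= 2 * h ->
  (cycle_match h k (prevp h p) == p) + (cycle_match h k p == nextp h p) +
    (k == p) = 1.
Proof. rewrite /cycle_match /prevp /nextp => *; ifs. Qed.

Lemma cycle_match_next h k p : 0 < h -> k <= 2 * h -> p <= 2 * h ->
  (cycle_match h k p == nextp h p) = (k != p) && (odd (p + k) == (k < p)).
Proof. rewrite /cycle_match /nextp => *; ifs. Qed.

Lemma cycle_match_sym h k p q :
  k <= 2 * h -> p <= (2 * h).+1 -> q <= (2 * h).+1 ->
  (cycle_match h k p == q) = (cycle_match h k q == p).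
Proof. by move=> lek lep leq; apply/eqP/eqP => <-; rewrite cycle_matchK. Qed.

Lemma cycle_match_apex h k q : k <= 2 * h -> q <= 2 * h ->
  (cycle_match h k (2 * h).+1 == q) = (k == q).
Proof. by rewrite /cycle_match eqxx. Qed.

Lemma cycle_match_adj h k p q : k <= 2 * h -> p <= 2 * h -> q <= 2 * h ->
  cycle_match h k p = q -> adj h p q.
Proof. rewrite /cycle_match /adj /nextp => *; ifs. Qed.

(** Moving the missed place from [k] to [k.+2] only replaces the cycle edge
    between [k.+1] and [k.+2] by the one between [k] and [k.+1], and the edge at
    the apex. *)
Lemma cycle_match_step2 h k p : k.+2 <= 2 * h ->
  p \notin [:: k; k.+1; k.+2; (2 * h).+1] ->
  cycle_match h k.+2 p = cycle_match h k p.
Proof. rewrite !inE /cycle_match => *; ifs. Qed.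

Definition near_factor h i k x := walecki h i (cycle_match h k (place h i x)).

Lemma near_factor_matching h i k : i < h -> k <= 2 * h ->
  is_matching h.+1 (near_factor h i k).
Proof.
move=> lti lek x; rewrite (_ : 2 * h.+1 = (2 * h).+2) ?ltnS; last by lia.
move=> lex; have lep := place_le lti lex; have les := cycle_match_le lek lep.
have lew := walecki_le lti les; split=> //; rewrite /near_factor.
  by rewrite waleckiK // cycle_matchK // placeK.
apply/eqP => /(congr1 (place h i)); rewrite waleckiK //.
by apply/eqP; rewrite cycle_match_neq.
Qed.

Lemma near_factorE h i k p : i < h -> p <= (2 * h).+1 ->
  near_factor h i k (walecki h i p) = walecki h i (cycle_match h k p).
Proof. by move=> lti lep; rewrite /near_factor waleckiK. Qed.

Lemma near_val h i k p x y : i < h -> p <= (2 * h).+1 ->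
  x = walecki h i p -> y = walecki h i (cycle_match h k p) ->
  near_factor h i k x = y.
Proof. by move=> lti lep -> ->; rewrite near_factorE. Qed.

Lemma near_factor_sym h i k x y : i < h -> k <= 2 * h -> x < 2 * h.+1 ->
  near_factor h i k x = y -> near_factor h i k y = x.
Proof.
by move=> lti lek ltx <-; have [] := near_factor_matching lti lek ltx.
Qed.

Lemma near_factor_eq h i k x y : i < h -> k <= 2 * h -> x <= (2 * h).+1 ->
  y <= (2 * h).+1 ->
  (near_factor h i k x == y) =
  (cycle_match h k (place h i x) == place h i y).
Proof.
move=> lti lek lex ley; rewrite -{1}(placeK lti ley) walecki_eq ?place_le //.
by rewrite cycle_match_le ?place_le.
Qed.

(** An edge of a cycle lies in no cycle factor of another cycle. *)
Lemma near_factor_disjoint h i l k p : 0 < h -> i < h -> l < h -> i != l ->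
  k <= 2 * h -> p <= 2 * h ->
  near_factor h i k (walecki h l p) <> walecki h l (nextp h p).
Proof.
move=> h0 lti ltl neq lek lep; set x := walecki h l p; set y := walecki h l _.
have leq := nextp_le lep.
have wle r : r <= 2 * h -> walecki h l r <= 2 * h.
  rewrite /walecki => ler; ifs.
have [lex ley] : x <= 2 * h /\ y <= 2 * h by rewrite !wle.
have neq_xy : x != y by rewrite cycle_edge_neq.
have adj_l : adj h (place h l x) (place h l y).
  by rewrite !waleckiK ?leqW // /adj eqxx.
move/eqP; rewrite near_factor_eq ?leqW // => /eqP.
have leP z : z <= 2 * h -> place h i z <= 2 * h.
  by rewrite /place /zig => *; ifs.
move/(cycle_match_adj lek (leP _ lex) (leP _ ley)).
move: adj_l; rewrite !adj_cycle_of // => /eqP el /eqP ei.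
by rewrite ei -el eqxx in neq.
Qed.

(** * The cycle factors cover every edge h times *)

Lemma count_parity b a l :
  count (fun k => odd k == b) (iota a l) = (l + (odd a == b))./2.
Proof.
elim: l a => [|l IH] a /=; first by case: eqP.
by rewrite IH /=; case: (odd a); case: (b); rewrite /=; lia.
Qed.

(** The missed places [k] are p + 2, p + 4, and so on around the cycle until
    p - 1. *)
Lemma count_next h p : 0 < h -> p <= 2 * h ->
  count (fun k => cycle_match h k p == nextp h p) (iota 0 (2 * h).+1) = h.
Proof.
move=> h0 lep; have -> : (2 * h).+1 = p + (1 + (2 * h - p)) by lia.
rewrite iotaD count_cat add0n iotaD count_cat /= addn1.
rewrite (_ : cycle_match h p p == _ = false) ?add0n; last first.
  by rewrite cycle_match_next // eqxx.
have -> : count (fun k => cycle_match h k p == nextp h p) (iota 0 p) =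
    count (fun k => odd k == ~~ odd p) (iota 0 p).
  apply: eq_in_count => k; rewrite mem_iota => kP.
  by rewrite cycle_match_next //; lia.
have -> :
    count (fun k => cycle_match h k p == nextp h p) (iota p.+1 (2 * h - p)) =
    count (fun k => odd k == odd p) (iota p.+1 (2 * h - p)).
  apply: eq_in_count => k; rewrite mem_iota => kP.
  by rewrite cycle_match_next //; lia.
rewrite !count_parity /=; case: (boolP (odd p)) => /=; lia.
Qed.

Lemma count_cycle_match h p q : 0 < h -> p <= (2 * h).+1 -> q <= (2 * h).+1 ->
  p != q ->
  count (fun k => cycle_match h k p == q) (iota 0 (2 * h).+1) =
  if (p == (2 * h).+1) || (q == (2 * h).+1) then 1 else adj h p q * h.
Proof.
move=> h0 lep leq neq.
have leK k : k \in iota 0 (2 * h).+1 -> k <= 2 * h by rewrite mem_iota; lia.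
have sym : count (fun k => cycle_match h k p == q) (iota 0 (2 * h).+1) =
           count (fun k => cycle_match h k q == p) (iota 0 (2 * h).+1).
  by apply: eq_in_count => k /leK lek; rewrite cycle_match_sym.
have inf r : r <= 2 * h ->
    count (fun k => cycle_match h k (2 * h).+1 == r) (iota 0 (2 * h).+1) = 1.
  move=> ler; rewrite (eq_in_count (a2 := pred1 r)); last first.
    by move=> k /leK lek; rewrite cycle_match_apex.
  by rewrite count_uniq_mem ?iota_uniq // mem_iota add0n ltnS ler.
have [ep|np] := eqVneq p (2 * h).+1; first by rewrite ep inf //; lia.
have [eq|nq] := eqVneq q (2 * h).+1; first by rewrite sym eq inf //; lia.
rewrite orFb; have [lep' leq'] : p <= 2 * h /\ q <= 2 * h by lia.
rewrite /adj; have [->|nqp] := eqVneq q (nextp h p).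
  by rewrite count_next // mul1n.
have [ep|npq] := eqVneq p (nextp h q).
  by rewrite sym ep count_next // orbT mul1n.
rewrite mul0n (eq_in_count (a2 := pred0)) ?count_pred0 // => k /leK lek /=.
apply/eqP => /(cycle_match_adj lek lep' leq').
by rewrite /adj (negPf nqp) (negPf npq).
Qed.

Lemma count_allpairs (A B : Type) (P : A * B -> bool) (s : seq A) (t : seq B) :
  count P [seq (a, b) | a <- s, b <- t] =
  \sum_(a <- s) count (fun b => P (a, b)) t.
Proof.
rewrite count_flatten sumnE !big_map; apply: eq_bigr => a _.
by rewrite count_map.
Qed.

Lemma sum_pick h c X : c < h -> \sum_(i <- iota 0 h) (i == c) * X = X.
Proof.
move=> ltc; rewrite -big_distrl /= (bigD1_seq c) ?iota_uniq ?mem_iota //=.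
by rewrite eqxx big1 ?mul1n // => i /negPf->.
Qed.

Definition all_indices h :=
  [seq (i, k) | i <- iota 0 h, k <- iota 0 (2 * h).+1].

Lemma mem_all_indices h i k :
  ((i, k) \in all_indices h) = (i < h) && (k <= 2 * h).
Proof.
rewrite /all_indices; apply/allpairsP/andP => [[[i' k'] []]|[lti lek]].
  by rewrite !mem_iota /= => ? ? [-> ->]; split; lia.
by exists (i, k); rewrite !mem_iota; split=> //=; lia.
Qed.

Lemma all_indices_uniq h : uniq (all_indices h).
Proof. by apply: allpairs_uniq; rewrite ?iota_uniq // => -[? ?] [? ?]. Qed.

(** An edge at the apex is covered once by every cycle, any other edge [h]
    times by the cycle that contains it. *)
Lemma count_all_indices h x y : 0 < h -> x < 2 * h.+1 -> y < 2 * h.+1 ->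
  x != y ->
  count (fun t => near_factor h t.1 t.2 x == y) (all_indices h) = h.
Proof.
move=> h0 ltx lty neq; rewrite count_allpairs.
have [lex ley] : x <= (2 * h).+1 /\ y <= (2 * h).+1 by lia.
have term i : i \in iota 0 h ->
    count (fun k => near_factor h i k x == y) (iota 0 (2 * h).+1) =
    if (x == (2 * h).+1) || (y == (2 * h).+1) then 1
    else (i == cycle_of h x y) * h.
  rewrite mem_iota => lti.
  have {}lti : i < h by lia.
  rewrite (eq_in_count
    (a2 := fun k => cycle_match h k (place h i x) == place h i y));
    last by move=> k; rewrite mem_iota => kP; rewrite near_factor_eq //; lia.
  have neqp : place h i x != place h i y.
    by apply: contra_neq neq => eq_xy; rewrite -(placeK lti lex) eq_xy placeK.
  rewrite count_cycle_match ?place_le //.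
  have inf z : z <= (2 * h).+1 ->
      (place h i z == (2 * h).+1) = (z == (2 * h).+1).
    rewrite /place /zig => *; ifs.
  rewrite !inf //; case: ifP => // /norP[nx ny].
  by rewrite adj_cycle_of //; lia.
rewrite (eq_big_seq _ term); case: (boolP (_ || _)) => [_|/norP[nx ny]].
  by rewrite sum1_size size_iota.
by rewrite sum_pick // cycle_of_lt //; lia.
Qed.

(** * The pairing of antipodes and the middle factors *)

(** Each residue is paired with its antipode modulo [2 * h], and the hub with
    the apex. *)
Definition diameter h x :=
  if x == 2 * h then (2 * h).+1
  else if x == (2 * h).+1 then 2 * h
  else if x < h then x + h else x - h.

Lemma diameter_matching h : is_matching h.+1 (diameter h).
Proof. rewrite /diameter => x ltx; split; ifs. Qed.

(** The indices of the cycle factors of the two middle places. *)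
Definition halves h := [seq (i, k) | i <- iota 0 h, k <- [:: h; h.+1]].

Lemma mem_halves h i k :
  ((i, k) \in halves h) = (i < h) && (k \in [:: h; h.+1]).
Proof.
apply/allpairsP/andP => [[[i' k'] []]|[lti kP]].
  by rewrite mem_iota /= => ? ? [-> ->].
by exists (i, k); rewrite mem_iota.
Qed.

Lemma halves_uniq h : uniq (halves h).
Proof.
apply: allpairs_uniq; rewrite ?iota_uniq //; last by move=> [? ?] [? ?].
by rewrite /= inE andbT; lia.
Qed.

(** The matchings that miss two consecutive places take complementary edges
    all around the cycle, and both omit the edge between these places. *)
Lemma cycle_match_middle h p q :
  0 < h -> p <= (2 * h).+1 -> q <= (2 * h).+1 -> p != q ->
  (cycle_match h h p == q) + (cycle_match h h.+1 p == q) =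
  if p == (2 * h).+1 then q \in [:: h; h.+1]
  else if q == (2 * h).+1 then p \in [:: h; h.+1]
  else adj h p q && ~~ ((p \in [:: h; h.+1]) && (q \in [:: h; h.+1])).
Proof. rewrite /cycle_match /adj /nextp !inE => *; ifs. Qed.

(** The cycle in which residue [x] is at one of the two middle places. *)
Definition middle_cycle h x :=
  let r := if x < h then x else x - h in
  if r < uphalf h then r + h./2 else r - uphalf h.

Lemma place_middle h i x : i < h -> x <= (2 * h).+1 ->
  (place h i x \in [:: h; h.+1]) = (x < 2 * h) && (i == middle_cycle h x).
Proof. rewrite /place /zig /middle_cycle !inE => *; ifs. Qed.

Lemma middle_cycle_lt h x : 0 < h -> x < 2 * h -> middle_cycle h x < h.
Proof. rewrite /middle_cycle => *; ifs. Qed.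

(** The middle points of a cycle are antipodes, and each pair of antipodes is
    in the middle of exactly one cycle. *)
Lemma diameter_middle h x y : x < 2 * h -> y < 2 * h -> x != y ->
  (diameter h x == y) =
  (cycle_of h x y == middle_cycle h x) && (cycle_of h x y == middle_cycle h y).
Proof. rewrite /diameter /cycle_of /middle_cycle => *; ifs. Qed.

(** The middle factors and the pairing of antipodes form a 1-factorization of
    the complete graph. *)
Lemma count_halves h x y : 0 < h -> x < 2 * h.+1 -> y < 2 * h.+1 -> x != y ->
  count (fun t => near_factor h t.1 t.2 x == y) (halves h) +
    (diameter h x == y) = 1.
Proof.
move=> h0 ltx lty neq; rewrite count_allpairs.
have [lex ley] : x <= (2 * h).+1 /\ y <= (2 * h).+1 by lia.
have inf i z : i < h -> z <= (2 * h).+1 ->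
    (place h i z == (2 * h).+1) = (z == (2 * h).+1).
  rewrite /place /zig => *; ifs.
have term i : i \in iota 0 h ->
    count (fun k => near_factor h i k x == y) [:: h; h.+1] =
    if x == (2 * h).+1 then (i == middle_cycle h y) * (y < 2 * h)
    else if y == (2 * h).+1 then (i == middle_cycle h x) * (x < 2 * h)
    else (i == cycle_of h x y) * (diameter h x != y).
  rewrite mem_iota => lti; have {}lti : i < h by lia.
  have neqp : place h i x != place h i y.
    by apply: contra_neq neq => eq_xy; rewrite -(placeK lti lex) eq_xy placeK.
  rewrite /= addn0 !near_factor_eq //; try lia.
  rewrite cycle_match_middle ?place_le // !inf // !place_middle //.
  rewrite mulnb [in LHS]andbC.
  case: ifP => // nx; case: ifP => [_|ny]; first by rewrite mulnb andbC.
  have [lex2 ley2] : x <= 2 * h /\ y <= 2 * h by lia.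
  rewrite adj_cycle_of // mulnb.
  have [->|//] := eqVneq i (cycle_of h x y); rewrite /=.
  have [ltx2|] := boolP (x < 2 * h); last by rewrite /= /diameter; ifs.
  have [lty2|] := boolP (y < 2 * h); last by rewrite /= andbF /diameter; ifs.
  by rewrite diameter_middle // andTb andbT.
rewrite (eq_big_seq _ term).
have [ex|nx] := eqVneq x (2 * h).+1.
  subst x; rewrite /diameter eqxx.
  have [lty2|] := boolP (y < 2 * h); last first.
    by move=> ge; rewrite big1 => [|i _]; [ifs|rewrite muln0].
  by rewrite sum_pick ?middle_cycle_lt //; ifs.
have [ey|ny] := eqVneq y (2 * h).+1.
  subst y; rewrite /diameter.
  have [ltx2|] := boolP (x < 2 * h); last first.
    by move=> ge; rewrite big1 => [|i _]; [ifs|rewrite muln0].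
  by rewrite sum_pick ?middle_cycle_lt //; ifs.
by rewrite sum_pick ?cycle_of_lt //; lia.
Qed.

(** Antipodes are adjacent in a cycle only in its middle. *)
Lemma diameter_disjoint h l p : 0 < h -> l < h -> p <= 2 * h ->
  diameter h (walecki h l p) = walecki h l (nextp h p) -> p = h.
Proof.
move=> h0 ltl lep; set x := walecki h l p; set y := walecki h l _.
have leq := nextp_le lep.
have wle r : r <= 2 * h -> walecki h l r <= 2 * h.
  rewrite /walecki => ler; ifs.
have [lex ley] : x <= 2 * h /\ y <= 2 * h by rewrite !wle.
have neq_xy : x != y by rewrite cycle_edge_neq.
have := adj_cycle_of ltl lex ley neq_xy.
rewrite !waleckiK ?leqW // /adj eqxx /= => /esym/eqP el dxy.
have [ltx lty] : x < 2 * h /\ y < 2 * h.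
  by move: dxy lex ley; rewrite /diameter; ifs.
move/eqP: dxy; rewrite diameter_middle // -el => /andP[midx midy].
have := place_middle ltl (leqW lex); have := place_middle ltl (leqW ley).
rewrite !waleckiK ?leqW // midx midy ltx lty !inE /nextp; ifs.
Qed.

(** * Balance of a sub-factorization at a cycle *)

Definition cycle_factor h l k := factor_of h.+1 (near_factor h l k).

Definition cycle_edge h l p :=
  edge h.+1 (walecki h l p) (walecki h l (nextp h p)).

Lemma mem_cycle_edge h l p g : l < h -> p <= 2 * h -> is_matching h.+1 g ->
  (cycle_edge h l p \in factor_of h.+1 g) =
  (g (walecki h l p) == walecki h l (nextp h p)).
Proof.
move=> ltl lep gM; rewrite mem_factor ?cycle_edge_neq //.
  by rewrite walecki_lt // leqW.
by rewrite walecki_lt // leqW // nextp_le.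
Qed.

Lemma mem_cycle_factor h l k p : l < h -> k <= 2 * h -> p <= 2 * h ->
  (cycle_edge h l p \in cycle_factor h l k) =
  (cycle_match h k p == nextp h p).
Proof.
move=> ltl lek lep; rewrite mem_cycle_edge //; last exact: near_factor_matching.
by rewrite near_factorE ?walecki_eq ?cycle_match_le ?leqW ?nextp_le.
Qed.

Lemma cycle_factor_inj h l k k' : l < h -> k <= 2 * h -> k' <= 2 * h ->
  (cycle_factor h l k == cycle_factor h l k') = (k == k').
Proof.
move=> ltl lek lek'; apply/eqP/eqP => [eq_cyc|-> //].
have := @factor_of_inj h.+1 _ _ (2 * h).+1 (near_factor_matching ltl lek)
  (near_factor_matching ltl lek') eq_cyc.
have -> : (2 * h).+1 = walecki h l (2 * h).+1 by rewrite /walecki; ifs.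
rewrite !near_factorE // => /(_ (walecki_lt ltl (leqnn _)))/eqP.
by rewrite walecki_eq ?cycle_match_le // /cycle_match eqxx => /eqP.
Qed.

Definition cycle_factors h l :=
  [seq cycle_factor h l k | k <- iota 0 (2 * h).+1].

Lemma mem_cycle_factors h l G :
  reflect (exists2 k, k <= 2 * h & G = cycle_factor h l k)
          (G \in cycle_factors h l).
Proof.
apply: (iffP mapP) => -[k]; rewrite ?mem_iota => kP ->; exists k => //.
by rewrite mem_iota; lia.
Qed.

(** For a 1-factor that respects cycle [l], see [respects], a stray is one
    that covers an edge of this cycle without being a cycle factor. *)
Definition stray h l (G : {set {set 'I_(2 * h.+1)}}) : bool :=
  (G \notin cycle_factors h l) && (cycle_edge h l h \in G).

Definition respects h l (G : {set {set 'I_(2 * h.+1)}}) : Prop :=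
  G \notin cycle_factors h l ->
  forall p, p <= 2 * h -> cycle_edge h l p \in G -> p = h.

(** At place [p] a cycle factor has one of the two cycle edges or joins [p]
    to the apex. The only other contribution is that of the middle edge,
    whose ends are the places [h] and [h.+1]. *)
Lemma local_balance h l (G : {set {set 'I_(2 * h.+1)}}) p :
  l < h -> p <= 2 * h -> respects l G ->
  (cycle_edge h l (prevp h p) \in G) + (cycle_edge h l p \in G) +
    (G == cycle_factor h l p) =
  (G \in cycle_factors h l) + (p \in [:: h; h.+1]) * stray l G.
Proof.
move=> ltl lep; rewrite /respects /stray.
have [Gcyc _|GNcyc /(_ isT) sparse] := boolP (G \in cycle_factors h l).
  rewrite muln0; case/mem_cycle_factors: Gcyc => k lek ->.
  rewrite !mem_cycle_factor ?prevp_le // prevpK // cycle_factor_inj //.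
  rewrite cycle_match_vertex //.
  exact: leq_ltn_trans ltl.
have -> : (G == cycle_factor h l p) = false.
  by apply: contraNF GNcyc => /eqP->; apply/mem_cycle_factors; exists p.
have at_h q : q <= 2 * h ->
    (cycle_edge h l q \in G) = (q == h) && (cycle_edge h l h \in G).
  move=> leq; apply/idP/andP => [qG|[/eqP->//]].
  by have qh := sparse q leq qG; move: qG; rewrite qh eqxx.
rewrite (at_h _ (prevp_le lep)) (at_h _ lep) !inE /prevp.
by case: (cycle_edge h l h \in G); ifs.
Qed.

Lemma global_balance h l lam0 (M0 : {mset {set {set 'I_(2 * h.+1)}}}) p :
  l < h -> p <= 2 * h -> one_factorization lam0 M0 ->
  (forall G, G \in M0 -> respects l G) ->
  2 * lam0 + M0 (cycle_factor h l p) =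
  count (mem (cycle_factors h l)) (enum_mset M0) +
    (p \in [:: h; h.+1]) * count (stray l) (enum_mset M0).
Proof.
move=> ltl lep [_ cov] M0l.
have cov_cycle q : q <= 2 * h ->
    count (fun G : {set {set 'I_(2 * h.+1)}} => cycle_edge h l q \in G)
      (enum_mset M0) = lam0.
  move=> leq; apply/cov/edge_is_edge; last exact: cycle_edge_neq.
    by rewrite walecki_lt // leqW.
  by rewrite walecki_lt // leqW // nextp_le.
rewrite -(count_mem_mset (cycle_factor h l p) M0) mul2n -addnn.
rewrite -{1}(cov_cycle (prevp h p)) ?prevp_le // -(cov_cycle p) //.
rewrite -!sumn_count !sumnE !big_map big_distrr -!big_split /=.
apply: eq_big_seq => G GM0; apply: local_balance => //.
exact: M0l.
Qed.

Lemma count_eq0 (T : eqType) (P : pred T) s :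
  (forall G, G \in s -> ~~ P G) -> count P s = 0.
Proof.
by move=> sP; rewrite -(count_pred0 s); apply: eq_in_count => G /sP/negPf.
Qed.

Lemma count_split (T : eqType) (A B C : pred T) s :
  (forall x, x \in s -> A x = B x + C x :> nat) ->
  count A s = count B s + count C s.
Proof.
elim: s => //= x s IH H; rewrite (H x) ?mem_head // IH 1?addnACA // => y ys.
by apply: H; rewrite inE ys orbT.
Qed.

Lemma leq_count_add (T : eqType) (A B C : pred T) s :
  (forall x, x \in s -> A x + B x <= C x) ->
  count A s + count B s <= count C s.
Proof.
elim: s => //= x s IH H; rewrite addnACA leq_add ?H ?mem_head // IH // => y ys.
by apply: H; rewrite inE ys orbT.
Qed.

(** Comparing place [a] with the places off the middle shows that there are
    no strays in [M0], then that no cycle factor is left. *)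
Lemma sub_index0_of_missing_middle h l lam0
    (M0 : {mset {set {set 'I_(2 * h.+1)}}}) a :
  1 < h -> l < h -> one_factorization lam0 M0 ->
  (forall G, G \in M0 -> respects l G) ->
  a \in [:: h; h.+1] -> M0 (cycle_factor h l a) = 0 -> lam0 = 0.
Proof.
move=> h1 ltl fact0 M0l aP M0a.
have bal p lep := global_balance (p := p) ltl lep fact0 M0l.
have lea : a <= 2 * h by move: aP; rewrite !inE; lia.
have bal_a := bal a lea; rewrite aP M0a in bal_a.
have bal_0 := bal 0 isT; rewrite !inE in bal_0.
suff : count (mem (cycle_factors h l)) (enum_mset M0) = 0 by lia.
apply: count_eq0 => G GM0; apply/negP => /mem_cycle_factors[k lek eG].
have : 0 < M0 (cycle_factor h l k) by rewrite -eG mset_gt0.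
by have := bal k lek; case: (k \in _); lia.
Qed.

(** Off the middle all multiplicities agree, hence vanish. The two middle
    cycle factors have as many occurrences as there are strays, and there are
    2 lam0 cycle factors in all. *)
Lemma sub_index_of_missing h l lam0
    (M0 : {mset {set {set 'I_(2 * h.+1)}}}) p :
  1 < h -> l < h -> one_factorization lam0 M0 ->
  (forall G, G \in M0 -> respects l G) ->
  p <= 2 * h -> p \notin [:: h; h.+1] -> M0 (cycle_factor h l p) = 0 ->
  lam0 = count (stray l) (enum_mset M0).
Proof.
move=> h1 ltl fact0 M0l lep pP M0p.
have bal q leq := global_balance (p := q) ltl leq fact0 M0l.
have bal_p := bal p lep.
rewrite (negPf pP) M0p mul0n !addn0 in bal_p.
have [leh leh1] : h <= 2 * h /\ h.+1 <= 2 * h by lia.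
have := bal h leh; rewrite inE eqxx mul1n bal_p => /addnI eq_h.
have := bal _ leh1; rewrite !inE eqxx orbT mul1n bal_p => /addnI eq_h1.
have two_middle : count (mem (cycle_factors h l)) (enum_mset M0) =
    M0 (cycle_factor h l h) + M0 (cycle_factor h l h.+1).
  rewrite -(count_mem_mset (cycle_factor h l h) M0).
  rewrite -(count_mem_mset (cycle_factor h l h.+1) M0).
  apply: count_split => G GM0 /=.
  have [/mem_cycle_factors[k lek eG]|GN] := boolP (G \in cycle_factors h l).
    have : 0 < M0 (cycle_factor h l k) by rewrite -eG mset_gt0.
    rewrite eG !cycle_factor_inj //; try lia.
    have := bal k lek; rewrite bal_p !inE.
    by case: (eqVneq k h) => [ek|nk]; case: (eqVneq k h.+1) => [e|ne]; lia.
  have notin k : k <= 2 * h -> (G == cycle_factor h l k) = false.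
    move=> lek; apply: contraNF GN => /eqP->.
    by apply/mem_cycle_factors; exists k.
  by rewrite !notin //; lia.
rewrite two_middle eq_h eq_h1 addnn -mul2n in bal_p.
by move/eqP: bal_p; rewrite eqn_pmul2l // => /eqP.
Qed.

(** A cycle factor cannot be confused with a stray, since it has a cycle edge
    that is not the middle one. *)
Lemma cycle_factor_off_middle h k : 1 < h -> k <= 2 * h ->
  exists2 p, (p <= 2 * h) && (p != h) & cycle_match h k p == nextp h p.
Proof.
move=> h1 lek; pose p := nextp h k; pose q := nextp h (nextp h p).
have [eq_h|neq_h] := eqVneq p h.
  exists q; rewrite /q ?cycle_match_next ?nextp_le //;
    by move: eq_h; rewrite /p /nextp; ifs.
by exists p; rewrite ?cycle_match_next; move: neq_h; rewrite /p /nextp; ifs.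
Qed.

(** The first component of the index of a cycle factor is its cycle, and a
    trade keeps the indices: those with first component [l] must not be traded,
    the others may share only the middle edge with cycle [l]. *)
Definition respects_family h l (Phi : nat * nat -> nat -> nat)
    (t : nat * nat) : Prop :=
  is_matching h.+1 (Phi t) /\
  (if t.1 == l then t.2 <= 2 * h /\ Phi t =1 near_factor h l t.2
   else forall p, p <= 2 * h ->
     Phi t (walecki h l p) = walecki h l (nextp h p) -> p = h).

Lemma respects_family_sub h l Phi s : l < h ->
  (forall t, t \in s -> respects_family h l Phi t) ->
  forall G, G \in factors h.+1 Phi s -> respects l G.
Proof.
move=> ltl sup G /mem_factors[t /sup[tM tl] ->] notstar p lep.
rewrite mem_cycle_edge // => /eqP; move: tl.
case: eqP => [_ [let2 eq_t]|_]; last exact.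
case/negP: notstar; apply/mem_cycle_factors; exists t.2 => //.
by apply: eq_factor_of => x _; rewrite eq_t.
Qed.

Lemma cycle_factor_unique h l Phi s k : 1 < h -> l < h -> k <= 2 * h ->
  (forall t, t \in s -> respects_family h l Phi t) ->
  factors h.+1 Phi s (cycle_factor h l k) <= count_mem (l, k) s.
Proof.
move=> h1 ltl lek sup; rewrite mset_seqE count_map.
have [p /andP[lep p_h] kp] := cycle_factor_off_middle h1 lek.
have kM := near_factor_matching ltl lek.
have at_p g : is_matching h.+1 g -> factor_of h.+1 g = cycle_factor h l k ->
    g (walecki h l p) = walecki h l (nextp h p).
  move=> gM eq_g; apply/eqP; rewrite -mem_cycle_edge // eq_g.
  by rewrite mem_cycle_edge // near_factorE ?leqW // (eqP kp).
have sub t : t \in s -> factor_of h.+1 (Phi t) == cycle_factor h l k ->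
    t == (l, k).
  case/sup=> tM tl /eqP eq_t; move: tl.
  have [t1|_] := eqVneq t.1 l; last first.
    by move/(_ p lep (at_p _ tM eq_t)) => ph; rewrite ph eqxx in p_h.
  move=> [let2 eqt]; have : cycle_factor h l t.2 == cycle_factor h l k.
    by rewrite -eq_t; apply/eqP/eq_factor_of => x _; rewrite eqt.
  by rewrite cycle_factor_inj // -t1 => /eqP<-; rewrite -surjective_pairing.
elim: s sub {sup} => //= t s IH sub; rewrite leq_add ?IH //.
  by case: eqP => // /eqP /(sub _ (mem_head _ _)) ->.
by move=> u us; apply: sub; rewrite inE us orbT.
Qed.

(** * The case lam = n *)

(** Index [(h, 0)] is free for the pairing of antipodes, since cycles have
    numbers below [h]. *)
Definition base_family h (t : nat * nat) : nat -> nat :=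
  if t.1 == h then diameter h else near_factor h t.1 t.2.

(** On this hexagon the pairing of antipodes alternates with the cycle factor
    of place 2 of cycle 0, that is, of vertex 1. *)
Definition swap_set h := [:: 2 * h; (2 * h).+1; 0; h; h.+1; 1].

Definition traded_family h := trade (swap_set h) (0, 2) (h, 0) (base_family h).

Definition factor_list h := all_indices h ++ (h, 0) :: halves h.

Lemma factor_listP h t : 0 < h -> t \in factor_list h ->
  t = (h, 0) \/ t.1 < h /\ t.2 <= 2 * h.
Proof.
case: t => i k h0; rewrite mem_cat inE mem_all_indices mem_halves !inE.
case: eqP => [-> _|_ /=]; [by left|right; lia].
Qed.

Lemma count_factor_list h t : count_mem t (factor_list h) =
  (t \in all_indices h) + (t == (h, 0)) + (t \in halves h).
Proof.
rewrite count_cat /= !count_uniq_mem ?all_indices_uniq ?halves_uniq //.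
by rewrite addnA eq_sym.
Qed.

Lemma factor_list_base h : 5 < h ->
  (0, 2) \in factor_list h /\ (h, 0) \in factor_list h.
Proof.
move=> h5; rewrite !mem_cat mem_all_indices !inE eqxx orbT; split=> //; lia.
Qed.

Lemma near_factor02_apex h : 5 < h -> near_factor h 0 2 (2 * h).+1 = 1.
Proof.
by move=> h5; apply: (near_val (p := (2 * h).+1));
  rewrite /walecki /cycle_match; ifs.
Qed.

Lemma swap_set_closed h : 5 < h -> {in swap_set h, forall x, x < 2 * h.+1 /\
  (base_family h (0, 2) x \in swap_set h) &&
  (base_family h (h, 0) x \in swap_set h)}.
Proof.
move=> h5 x; rewrite !inE => xP; split; first by lia.
rewrite /base_family /= eqxx ifN; last by lia.
apply/andP; split.
  have lth : 0 < h by lia.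
  have e1 := near_factor02_apex h5.
  have e2 : near_factor h 0 2 1 = (2 * h).+1.
    apply: (near_val (p := 2)); rewrite /walecki /cycle_match; ifs.
  have e3 : near_factor h 0 2 0 = 2 * h.
    apply: (near_val (p := 1)); rewrite /walecki /cycle_match; ifs.
  have e4 : near_factor h 0 2 (2 * h) = 0.
    apply: (near_val (p := 0)); rewrite /walecki /cycle_match; ifs.
  have e5 : near_factor h 0 2 h = h.+1.
    apply: (near_val (p := (2 * h))); rewrite /walecki /cycle_match; ifs.
  have e6 : near_factor h 0 2 h.+1 = h.
    apply: (near_val (p := (2 * h).-1)); rewrite /walecki /cycle_match; ifs.
  by move: xP; do !case/orP; move=> /eqP->;
    rewrite ?(e1, e2, e3, e4, e5, e6); lia.
rewrite /diameter; ifs.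
Qed.

Lemma middle_notin_swap_set h : 5 < h -> walecki h 1 h \notin swap_set h.
Proof. by rewrite /walecki !inE => h5; ifs. Qed.

Lemma base_family_matching h t : 0 < h -> t \in factor_list h ->
  is_matching h.+1 (base_family h t).
Proof.
move=> h0 /(factor_listP h0)[->|[lti lek]]; rewrite /base_family /=.
  by rewrite eqxx; apply: diameter_matching.
by rewrite ltn_eqF //; apply: near_factor_matching.
Qed.

Lemma traded_family_matching h t : 5 < h -> t \in factor_list h ->
  is_matching h.+1 (traded_family h t).
Proof.
move=> h5 ts; have [in1 in2] := factor_list_base h5; have h0 : 0 < h by lia.
apply: trade_matching; try exact: base_family_matching.
exact: swap_set_closed.
Qed.

Lemma count_traded_family h x y : 5 < h -> x < 2 * h.+1 -> y < 2 * h.+1 ->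
  x != y -> count (fun t => traded_family h t x == y) (factor_list h) = h.+1.
Proof.
move=> h5 ltx lty neq; have h0 : 0 < h by lia.
rewrite count_trade; last first.
  rewrite !count_factor_list !mem_all_indices !mem_halves !inE !xpair_eqE; lia.
rewrite count_cat /= /base_family eqxx.
rewrite (eq_in_count (a2 := fun t => near_factor h t.1 t.2 x == y)); last first.
  case=> i k; rewrite mem_all_indices /= => /andP[lti _].
  by rewrite (ltn_eqF lti).
rewrite count_all_indices //.
rewrite (eq_in_count (a2 := fun t => near_factor h t.1 t.2 x == y)); last first.
  by case=> i k; rewrite mem_halves /= => /andP[lti _]; rewrite (ltn_eqF lti).
by rewrite [_ + count _ _]addnC count_halves // addn1.
Qed.

Lemma traded_family_respects h l t :
  5 < h -> 0 < l < h -> t \in factor_list h ->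
  respects_family h l (traded_family h) t.
Proof.
move=> h5 /andP[l0 ltl] ts; have h0 : 0 < h by lia.
split; first exact: traded_family_matching.
have := factor_listP h0 ts; case: t ts => i k ts /=.
have [->|neq_il] := eqVneq i l.
  case=> [[el]|[_ lek]]; first by lia.
  split=> // x; rewrite /traded_family trade_other /base_family ?xpair_eqE /=.
  - by rewrite ltn_eqF.
  - by lia.
  - by lia.
move=> tP p lep; have [in1 in2] := factor_list_base h5.
have base u : u \in factor_list h -> u.1 != l ->
    base_family h u (walecki h l p) = walecki h l (nextp h p) -> p = h.
  case: u => i' k' us /= neq; rewrite /base_family /=.
  case: eqP => [_|ne]; first exact: diameter_disjoint.
  case: (factor_listP h0 us) => [[]//|[/= lti lek]].
  by move/near_factor_disjoint=> H; case: H => //.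
rewrite /traded_family /trade; apply: base.
  by rewrite /transpose; do !case: ifP.
by rewrite /transpose; do !case: ifP => //= _; lia.
Qed.

Lemma exists_for_n h : 5 < h ->
  exists M : {mset {set {set 'I_(2 * h.+1)}}},
    [/\ one_factorization h.+1 M, indecomposable h.+1 M & ~ simple M].
Proof.
move=> h5; have h0 : 0 < h by lia. have h1 : 1 < h by lia.
pose M := factors h.+1 (traded_family h) (factor_list h); exists M.
have sup l : 0 < l < h -> forall t, t \in factor_list h ->
    respects_family h l (traded_family h) t.
  by move=> lP t; apply: traded_family_respects.
split.
- apply: one_factorization_factors => [t|x y].
    exact: traded_family_matching.
  exact: count_traded_family.
- apply: (@indecomposable_of_unique _ _ _ (cycle_factor h 1 0)).
    apply: leq_trans (cycle_factor_unique _ _ _ (sup 1 _)) _ => //; try lia.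
    rewrite count_factor_list mem_all_indices mem_halves !inE xpair_eqE; lia.
  move=> lam0 M0 fact0 M0M M0F.
  have comp l : 0 < l < h -> forall G, G \in M0 -> respects l G.
    move=> lP G /M0M; apply: respects_family_sub; last exact: sup.
    by case/andP: lP.
  (* Each copy of a middle edge of cycle 1 in M0 outside the cycle factors lies
     in the traded pairing of antipodes, which also contains the edge e below:
     the lam0 strays are then all the factors of M0 that contain e. *)
  have lam0E := sub_index_of_missing h1 h1 fact0 (comp 1 h1) (leq0n _) _ M0F.
  have {}lam0E : lam0 = count (stray 1) M0 by apply: lam0E; rewrite !inE; lia.
  (* Vertex 1 is an end of the middle edge of cycle j, so one of the two middle
     factors of this cycle joins the apex to vertex 1, that is, contains e. *)
  pose j := (h./2).+1; have jP : 0 < j < h by rewrite /j; lia.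
  have ltj : j < h by case/andP: jP.
  have [a aP wa] : exists2 a, a \in [:: h; h.+1] & walecki h j a = 1.
    exists (if odd h then h else h.+1); first by rewrite !inE; ifs.
    by rewrite /walecki /j; ifs.
  have lea : a <= 2 * h by move: aP; rewrite !inE; lia.
  suff M0a : M0 (cycle_factor h j a) = 0.
    exact: (sub_index0_of_missing_middle h1 ltj fact0 (comp j jP) aP M0a).
  pose e := edge h.+1 (2 * h).+1 1.
  have cov_e : count (fun G : {set {set 'I_(2 * h.+1)}} => e \in G)
      (enum_mset M0) = lam0.
    by case: fact0 => _; apply; apply: edge_is_edge; lia.
  have jM := near_factor_matching ltj lea.
  have neq_j1 : 1 != j by rewrite /j; lia.
  have e_cyc : e \in cycle_factor h j a.
    rewrite mem_factor //; try lia.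
    apply/eqP/(near_val (p := (2 * h).+1)) => //; first by rewrite /walecki; ifs.
    by rewrite /cycle_match eqxx wa.
  have cyc_not_stray : ~~ stray 1 (cycle_factor h j a).
    rewrite /stray mem_cycle_edge //; last by lia.
    rewrite negb_and orbC; apply/orP; left.
    by apply/eqP/near_factor_disjoint; lia.
  have stray_e G : G \in M0 -> stray 1 G -> e \in G.
    move=> /M0M/mem_factors[t ts ->] /andP[notstar].
    have [tM] := sup 1 h1 t ts; rewrite mem_cycle_edge //; last by lia.
    case: eqP => [t1 [let2 eq_t]|/eqP t1 _].
      case/negP: notstar; apply/mem_cycle_factors; exists t.2 => //.
      by apply: eq_factor_of => x _; rewrite eq_t.
    rewrite /traded_family trade_out ?middle_notin_swap_set //.
    rewrite mem_factor //; try lia.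
    case: (factor_listP h0 ts) => [-> _|[lti lek]].
      rewrite trade_in_r ?inE ?eqxx ?orbT // /base_family /=.
      by rewrite ifN ?near_factor02_apex //; lia.
    rewrite /base_family (ltn_eqF lti) => /eqP/near_factor_disjoint H.
    by case: H => //; lia.
  have : count (stray 1) M0 + count_mem (cycle_factor h j a) M0 <=
      count (fun G : {set {set 'I_(2 * h.+1)}} => e \in G) M0.
    apply: leq_count_add => G GM0 /=; case: eqP => [->|_].
      by rewrite (negPf cyc_not_stray) e_cyc.
    by rewrite addn0; case: (boolP (stray 1 G)) => // /stray_e->.
  by rewrite cov_e -lam0E count_mem_mset; lia.
- apply: (@not_simple_of_count _ _ _ _ (1, h)).
  rewrite count_factor_list mem_all_indices mem_halves !inE xpair_eqE; lia.
Qed.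

(** * The case lam = n - 1 *)

Definition walecki_family (h : nat) (t : nat * nat) : nat -> nat :=
  near_factor h t.1 t.2.

(** The configuration behind the two trades. The points v, x, b are
    consecutive in cycle 0, and [kv], [kb], [ku] are the places there of v, b
    and of a further point; [kj] is the place of v in cycle [j]. The cycle
    factors [ku] of cycle 0 and [kj] of cycle [j] alternate on the 4-cycle x,
    b, q, p: trading there gives the second one the edge xb besides its edge
    from v to the apex. It then alternates with the cycle factor [kb] of
    cycle 0 on the 4-cycle formed by the apex, b, x, v, and trading there
    turns [kb] into [kv]. *)
Record doubling h j kv kb ku kj v x b q p : Prop := Doubling {
  doubling_j : 1 < j < h;
  doubling_pos : [/\ kv <= 2 * h, kb <= 2 * h, ku <= 2 * h & kj <= 2 * h];
  doubling_pos_uniq : uniq [:: kv; kb; ku];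
  doubling_vertices : all (fun y => y < 2 * h) [:: v; x; b; q; p];
  doubling_uniq : uniq [:: v; x; b; q; p];
  doubling_u : near_factor h 0 ku x = b /\ near_factor h 0 ku q = p;
  doubling_jv : [/\ near_factor h j kj x = p, near_factor h j kj b = q
                & near_factor h j kj (2 * h).+1 = v];
  doubling_b : near_factor h 0 kb x = v /\ near_factor h 0 kb (2 * h).+1 = b;
  doubling_v : near_factor h 0 kv x = b /\ near_factor h 0 kv (2 * h).+1 = v;
  doubling_eq : forall y, y < 2 * h.+1 -> y \notin [:: v; x; b; (2 * h).+1] ->
    near_factor h 0 kb y = near_factor h 0 kv y }.

(** Here cycle [j] has 0 in its middle, where it reads 1, h, 0, h + 1, -1,
    whereas cycle 0 starts with 0, 1, -1 after the hub and ends with h + 1,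
    h. *)
Lemma doubling_even h : 5 < h -> ~~ odd h ->
  doubling h h./2 1 3 4 h.+1 0 1 (2 * h).-1 h.+1 h.
Proof.
move=> h5 he; have h0 : 0 < h by lia. have hj : h./2 < h by lia.
split; rewrite /= ?inE; try (repeat split; lia).
- split; [apply: (near_val (p := 2))
          |apply: (near_val (p := (2 * h).-1))];
    rewrite /walecki /cycle_match; ifs.
- split; [apply: (near_val (p := h.-1))
          |apply: (near_val (p := h.+3))
          |apply: (near_val (p := (2 * h).+1))];
    rewrite /walecki /cycle_match; ifs.
- split; [apply: (near_val (p := 2))
          |apply: (near_val (p := (2 * h).+1))];
    rewrite /walecki /cycle_match; ifs.
- split; [apply: (near_val (p := 2))
          |apply: (near_val (p := (2 * h).+1))];
    rewrite /walecki /cycle_match; ifs.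
- move=> y lty; rewrite !inE => yP; rewrite /near_factor; congr (walecki _ _ _).
  apply: cycle_match_step2; first by lia.
  by move: yP; rewrite /place /zig !inE; ifs.
Qed.

(** Here cycle [j] starts with j, p, x after the hub and ends with q, b, v.
    In cycle 0, the edges xb and qp join residues of sum 1, and the cycle
    factor of the hub consists of all such edges besides the one from the hub
    to the apex. *)
Lemma doubling_odd h : 5 < h -> odd h ->
  doubling h (h.+1)./2 h h.-2 0 (2 * h)
    (h.+1./2 + h) h./2 (2 * h.+1 - h.+1./2) (h./2 + h) (h.+2 - h.+1./2).
Proof.
move=> h5 he; have h0 : 0 < h by lia. have hj : (h.+1)./2 < h by lia.
split; rewrite /= ?inE; try (repeat split; lia).
- split; [apply: (near_val (p := h.-1))
          |apply: (near_val (p := h.+2))];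
    rewrite /walecki /cycle_match; ifs.
- split; [apply: (near_val (p := 3))
          |apply: (near_val (p := (2 * h).-1))
          |apply: (near_val (p := (2 * h).+1))];
    rewrite /walecki /cycle_match; ifs.
- split; [apply: (near_val (p := h.-1))
          |apply: (near_val (p := (2 * h).+1))];
    rewrite /walecki /cycle_match; ifs.
- split; [apply: (near_val (p := h.-1))
          |apply: (near_val (p := (2 * h).+1))];
    rewrite /walecki /cycle_match; ifs.
- move=> y lty; rewrite !inE => yP; rewrite /near_factor; congr (walecki _ _ _).
  have := @cycle_match_step2 h h.-2 (place h 0 y).
  rewrite (_ : h.-2.+2 = h); last by lia.
  move=> step; apply/esym/step; first by lia.
  by move: yP; rewrite /place /zig !inE; ifs.
Qed.

Definition single_trade h j ku kj x b q p :=
  trade [:: x; b; q; p] (0, ku) (j, kj) (walecki_family h).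

Definition double_trade h j kb ku kj v x b q p :=
  trade [:: (2 * h).+1; b; x; v] (0, kb) (j, kj)
    (single_trade h j ku kj x b q p).

Lemma walecki_family_matching h t : t \in all_indices h ->
  is_matching h.+1 (walecki_family h t).
Proof.
case: t => i k; rewrite mem_all_indices => /andP[].
exact: near_factor_matching.
Qed.

Section Doubling.

Variables (h j kv kb ku kj v x b q p : nat).
Hypothesis (h5 : 5 < h) (D : doubling h j kv kb ku kj v x b q p).

Let once := single_trade h j ku kj x b q p.
Let twice := double_trade h j kb ku kj v x b q p.

Lemma doubling_indices :
  [/\ (0, kv) \in all_indices h, (0, kb) \in all_indices h,
      (0, ku) \in all_indices h & (j, kj) \in all_indices h].
Proof.
have [? ? ? ?] := doubling_pos D; have := doubling_j D.
by rewrite !mem_all_indices; split; lia.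
Qed.

Lemma once_matching t : t \in all_indices h -> is_matching h.+1 (once t).
Proof.
move=> ts; have [tv tb tu tj] := doubling_indices.
apply: trade_matching; try exact: walecki_family_matching.
have [e1 e2] := doubling_u D; have [e3 e4 _] := doubling_jv D.
have [_ _ leu lej] := doubling_pos D; have ltj := doubling_j D.
have /and5P[ltv ltx ltb ltq /andP[ltp _]] := doubling_vertices D.
have e1' : near_factor h 0 ku b = x by apply: near_factor_sym e1; lia.
have e2' : near_factor h 0 ku p = q by apply: near_factor_sym e2; lia.
have e3' : near_factor h j kj p = x by apply: near_factor_sym e3; lia.
have e4' : near_factor h j kj q = b by apply: near_factor_sym e4; lia.
have lt z : z < 2 * h -> z < 2 * h.+1 by lia.
move=> y; rewrite !inE /walecki_family /= => /or4P[]/eqP->;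
  split; try exact: lt;
  by rewrite ?(e1, e2, e3, e4) ?(e1', e2', e3', e4') ?eqxx ?orbT.
Qed.

Lemma once_kb y : once (0, kb) y = near_factor h 0 kb y.
Proof.
have ltj := doubling_j D.
have := doubling_pos_uniq D; rewrite /= !inE => ne.
by rewrite /once /single_trade trade_other //; rewrite xpair_eqE; lia.
Qed.

Lemma once_jkj :
  [/\ once (j, kj) (2 * h).+1 = v, once (j, kj) v = (2 * h).+1,
      once (j, kj) x = b & once (j, kj) b = x].
Proof.
have [e1 e2] := doubling_u D; have [e3 e4 e5] := doubling_jv D.
have [_ _ leu lej] := doubling_pos D; have ltj := doubling_j D.
have /and5P[ltv ltx ltb ltq /andP[ltp _]] := doubling_vertices D.
have := doubling_uniq D; rewrite /= !inE => ne.
rewrite /once /single_trade; split.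
- by rewrite trade_out // !inE; lia.
- rewrite trade_out ?inE; last by lia.
  by apply: near_factor_sym e5; lia.
- by rewrite trade_in_r ?inE ?eqxx.
- rewrite trade_in_r ?inE ?eqxx ?orbT //.
  by apply: near_factor_sym e1; lia.
Qed.

Lemma once_kb_values :
  [/\ once (0, kb) (2 * h).+1 = b, once (0, kb) b = (2 * h).+1,
      once (0, kb) x = v & once (0, kb) v = x].
Proof.
have [e1 e2] := doubling_b D.
have [_ leb _ _] := doubling_pos D.
have /and5P[ltv ltx ltb ltq /andP[ltp _]] := doubling_vertices D.
by rewrite !once_kb; split=> //; apply: near_factor_sym => //; lia.
Qed.

Lemma twice_matching t : t \in all_indices h -> is_matching h.+1 (twice t).
Proof.
move=> ts; have [tv tb tu tj] := doubling_indices.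
have [onceM once_j once_b] := And3 once_matching once_jkj once_kb_values.
rewrite /twice /double_trade -/once.
move: (once) onceM once_j once_b => Phi PhiM [e1 e2 e3 e4] [e5 e6 e7 e8].
apply: trade_matching; try exact: PhiM.
have /and5P[ltv ltx ltb ltq /andP[ltp _]] := doubling_vertices D.
have lt z : z < 2 * h -> z < 2 * h.+1 by lia.
have lt_apex : (2 * h).+1 < 2 * h.+1 by lia.
move=> y; rewrite !inE => /or4P[]/eqP->.
- by rewrite e1 e5 !eqxx ?orbT.
- by rewrite e4 e6 !eqxx ?orbT lt.
- by rewrite e3 e7 !eqxx ?orbT lt.
- by rewrite e2 e8 !eqxx ?orbT lt.
Qed.

Lemma twice_kb y : y < 2 * h.+1 -> twice (0, kb) y = near_factor h 0 kv y.
Proof.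
move=> lty; have [e1 e2 e3 e4] := once_jkj.
have [e5 e6] := doubling_v D; have [lev _ _ _] := doubling_pos D.
have /and5P[ltv ltx ltb ltq /andP[ltp _]] := doubling_vertices D.
rewrite /twice /double_trade.
have [yS|yS] := boolP (y \in [:: (2 * h).+1; b; x; v]).
  rewrite trade_in_l // -/once; move: yS; rewrite !inE => /or4P[]/eqP->.
  - by rewrite e1 e6.
  - by rewrite e4; apply/esym; apply: near_factor_sym e5; lia.
  - by rewrite e3 e5.
  - by rewrite e2; apply/esym; apply: near_factor_sym e6; lia.
rewrite trade_out // -/once once_kb; apply: (doubling_eq D) => //.
by move: yS; rewrite !inE; lia.
Qed.

Lemma twice_kv y : twice (0, kv) y = near_factor h 0 kv y.
Proof.
have ltj := doubling_j D; have := doubling_pos_uniq D; rewrite /= !inE => ne.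
rewrite /twice /double_trade trade_other ?xpair_eqE /=; try lia.
by rewrite /single_trade trade_other ?xpair_eqE //=; lia.
Qed.

Lemma count_twice y z : y < 2 * h.+1 -> z < 2 * h.+1 -> y != z ->
  count (fun t => twice t y == z) (all_indices h) = h.
Proof.
move=> lty ltz neq; have [tv tb tu tj] := doubling_indices.
rewrite !count_trade ?count_uniq_mem ?all_indices_uniq ?tb ?tu ?tj //.
by apply: count_all_indices => //; lia.
Qed.

Lemma twice_respects t : t \in all_indices h -> respects_family h 1 twice t.
Proof.
move=> ts; split; first exact: twice_matching.
have ltj := doubling_j D; have [tv tb tu tj] := doubling_indices.
have h1 : 1 < h by lia.
case: t ts => i k ts /=; have [ei|neq_i] := eqVneq i 1.
  have lek : k <= 2 * h by move: ts; rewrite mem_all_indices; lia.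
  split=> // y; rewrite /twice /double_trade.
  rewrite trade_other ?xpair_eqE ?ei /=; try lia.
  by rewrite /single_trade trade_other ?xpair_eqE //=; lia.
move=> r ler; pose avoids z := z = walecki h 1 (nextp h r) -> r = h.
have base u : u \in all_indices h -> u.1 != 1 ->
    avoids (walecki_family h u (walecki h 1 r)).
  case: u => i' k'; rewrite mem_all_indices => /andP[lti' lek'] /= neq.
  by move/near_factor_disjoint=> H; case: H => //; lia.
have j1 : j != 1 by lia.
by apply: (@trade_ind avoids); apply: (@trade_ind avoids); apply: base.
Qed.

Lemma exists_of_doubling :
  exists M : {mset {set {set 'I_(2 * h.+1)}}},
    [/\ one_factorization h M, indecomposable h M & ~ simple M].
Proof.
have h0 : 0 < h by lia. have h1 : 1 < h by lia.
exists (factors h.+1 twice (all_indices h)); split.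
- apply: one_factorization_factors; [exact: twice_matching|exact: count_twice].
- apply: (@indecomposable_of_unique _ _ _ (cycle_factor h 1 h)).
    apply: leq_trans (cycle_factor_unique h1 h1 _ twice_respects) _; first by lia.
    by rewrite count_uniq_mem ?all_indices_uniq // leq_b1.
  move=> lam0 M0 fact0 M0M M0F.
  apply: (sub_index0_of_missing_middle h1 h1 fact0 _ _ M0F).
    by move=> F /M0M; apply: (respects_family_sub h1 twice_respects).
  by rewrite inE eqxx.
- have [tv tb _ _] := doubling_indices.
  have := doubling_pos_uniq D; rewrite /= !inE => ne.
  have neq : (0, kb) != (0, kv) by rewrite xpair_eqE; lia.
  apply: (not_simple_of_eq tb tv neq); apply: eq_factor_of => y lty.
  by rewrite twice_kb ?twice_kv.
Qed.

End Doubling.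

Theorem proposition3 (n lam : nat) (hn : 7 <= n) (hlam : n - 1 <= lam <= n) :
  exists M : {mset {set {set 'I_(2 * n)}}},
    [/\ one_factorization lam M, indecomposable lam M & ~ simple M].
Proof.
case: n hn hlam => // h h6 /andP[h_le le_h].
have [->|] := eqVneq lam h.+1; first exact: exists_for_n.
move=> neq; have -> : lam = h by lia.
have [/(doubling_odd h6)|/(doubling_even h6)] := boolP (odd h);
  exact: exists_of_doubling.
Qed.
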